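(* Let $(\mathcal{F}_n)_{n<\omega}$ and $(\mathcal{G}_k)_{k<\omega}$ be sequences of filters on a set $X$, and let $\mathcal{F}:=\operatorname{Li}_{(n)}\mathcal{F}_n$ and $\mathcal{G}:=\operatorname{Li}_{(k)}\mathcal{G}_k$ be their contours. If $\mathcal{F}\#\mathcal{G}$, then (at least) one of the following statements holds: (A.1) there is a transversal set $A\subset\omega\times\omega$ such that $\mathcal{F}_n\#\mathcal{G}_k$ for each $(n,k)\in A$; (A.2) $\mathcal{F}\#\mathcal{G}_k$ for infinitely many $k$; (A.3) $\mathcal{F}_n\#\mathcal{G}$ for infinitely many $n$.
   Context: The contour of a sequence $(\mathcal{F}_n)_{n<\omega}$ of filters on $X$ is $\operatorname{Li}_{(n)}\mathcal{F}_n:=\bigcup_{m<\omega}\bigcap_{n>m}\mathcal{F}_n$ (a filter on $X$). Two families $\mathcal{A},\mathcal{B}$ of subsets of $X$ mesh, written $\mathcal{A}\#\mathcal{B}$, if $A\cap B\neq\varnothing$ for all $A\in\mathcal{A}$, $B\in\mathcal{B}$. A set $A\subset\omega\times\omega$ is transversal if $A$ is infinite and, for all $n,k<\omega$, each of the sets $\{l:(n,l)\in A\}$ and $\{m:(m,k)\in A\}$ has at most one element. *)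

(* Defs.v *)
From mathcomp Require Import all_boot.
From mathcomp Require Import mathcomp_extra boolp classical_sets functions.
From mathcomp Require Import cardinality filter.

Set Implicit Arguments.
Unset Strict Implicit.
Unset Printing Implicit Defensive.

Local Open Scope classical_set_scope.

(* Union and intersection are taken in the powerset of [set X]: a set belongs
   to the contour iff it belongs to [F n] for all sufficiently large [n]. *)
Definition contour (X : Type) (F : nat -> set_system X) : set_system X :=
  \bigcup_m \bigcap_(n in [set n | (m < n)%N]) F n.

Global Instance contour_filter (X : Type) (F : nat -> set_system X)
  (hF : forall n, Filter (F n)) : Filter (contour F).
Proof.
split.
- by exists 0 => // n _; exact: filterT.
- move=> P Q [m1 _ hP] [m2 _ hQ]; exists (maxn m1 m2) => // n.
  rewrite /= gtn_max => /andP[h1 h2].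
  by apply: filterI; [exact: hP | exact: hQ].
- move=> P Q PQ [m _ hP]; exists m => // n mn.
  exact: filterS PQ (hP n mn).
Qed.

Definition transversal_set (A : set (nat * nat)) : Prop :=
  infinite_set A /\
  forall n k : nat,
    is_subset1 [set l | A (n, l)] /\ is_subset1 [set m | A (m, k)].

(* Main.v *)
(* If all three alternatives fail, then from some index [N] on, no [F n] meshes
   with any [G k], no [F n] with [contour G], and no [G k] with [contour F].
   Pick disjoint [R n] in [F n] and [S n] in [contour G], disjoint [P k] in
   [contour F] and [Q k] in [G k], and disjoint [A n k] in [F n] and [B n k] in
   [G k].  For each pair [(n, k)] choose one of these three disjoint pairs,
   [C n k] in [F n] and [D n k] in [G k]: the pair [(R n, S n)] if [n <= k] and
   [S n] has already entered [G k], the pair [(P k, Q k)] if [k < n] and [P k]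
   has already entered [F n], and [(A n k, B n k)] otherwise.  Then [C n k] is
   [R n] for large [k] and [D n k] is [Q k] for large [n], so the intersections
   over [k] of the [C n k] belong to [F n], those over [n] of the [D n k] belong
   to [G k], and the unions of these intersections are disjoint members of the
   two contours. *)

Require Import Defs.
From mathcomp Require Import all_boot.
From mathcomp Require Import mathcomp_extra boolp classical_sets functions.
From mathcomp Require Import cardinality filter.

Set Implicit Arguments.
Unset Strict Implicit.
Unset Printing Implicit Defensive.

Local Open Scope classical_set_scope.

Lemma not_meets_disjoint (T : Type) (F G : set_system T) :
  ~ F `#` G -> exists A B, [/\ F A, G B & A `&` B = set0].
Proof.
move=> nFG; apply: contrapT => nAB; apply: nFG => A B FA GB.
by apply/set0P/eqP => AB0; apply: nAB; exists A, B.
Qed.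

Lemma not_infinite_nat_bound (P : set nat) :
  ~ infinite_set P -> exists N, forall n, N <= n -> ~ P n.
Proof.
move=> /contrapT/finite_seqP[s ->]; exists (\max_(i <- s) i).+1 => n sn /= ns.
by have := @leq_bigmax_seq _ s xpredT id n ns isT; rewrite leqNgt sn.
Qed.

Lemma ltn_homo_inj (f : nat -> nat) : {homo f : i j / i < j} -> injective f.
Proof. by move=> /leq_mono/incn_inj. Qed.

Lemma transversal_set_range (s : nat -> nat * nat) :
  injective (fst \o s) -> injective (snd \o s) -> transversal_set (range s).
Proof.
move=> s1 s2; split.
  have s_inj : injective s by move=> i j sij; apply: s1; rewrite /= sij.
  apply/infiniteP; have := inj_card_eq (in2W s_inj : {in [set: nat] &, injective s}).
  by rewrite card_eq_le => /andP[].
move=> n k; split=> [l1 l2|m1 m2] [i _ si] [j _ sj].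
  have ij : i = j by apply: s1; rewrite /= si sj.
  by move: si; rewrite ij sj => -[].
have ij : i = j by apply: s2; rewrite /= si sj.
by move: si; rewrite ij sj => -[].
Qed.

(** Only finitely many distinct sets are intersected: [R] and the [C k] with [k < N] already lie
    below the whole intersection. *)
Lemma filter_bigcap_eventually_cst (T : Type) (F : set_system T) (FF : Filter F)
  (C : nat -> set T) (R : set T) (N : nat) :
  F R -> (forall k, F (C k)) -> (forall k, N <= k -> C k = R) ->
  F (\bigcap_k C k).
Proof.
move=> FR FC CR.
have FI : F (R `&` [set x | forall i : 'I_N, C i x]).
  apply: filterI => //.
  by apply: (@filter_forall _ _ (fun i : 'I_N => C i)) => i; exact: FC.
apply: filterS FI => x [Rx Cx] k _.
by have [kN|/CR->//] := ltnP k N; exact: (Cx (Ordinal kN)).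
Qed.

Lemma contourP (T : Type) (F : nat -> set_system T) (A : set T) :
  contour F A <-> exists m, forall n, m < n -> F n A.
Proof. by split=> [[m _ FA]|[m FA]]; exists m. Qed.

(** Allows finitely many exceptional indices to be discarded. *)
Lemma contour_shift (T : Type) (F : nat -> set_system T) (N : nat) :
  contour (fun n => F (N + n)) = contour F.
Proof.
apply/seteqP; split=> A /contourP[m FA]; apply/contourP.
  exists (N + m) => n Nmn; have Nn : N <= n.
    by apply: leq_trans (ltnW Nmn); exact: leq_addr.
  by rewrite -(subnKC Nn); apply: FA; rewrite ltn_subRL.
by exists m => n mn; apply: FA; apply: leq_trans mn _; exact: leq_addl.
Qed.

Lemma contour_not_meets (X : Type) (F G : nat -> set_system X)
  (hF : forall n, Filter (F n)) (hG : forall k, Filter (G k)) :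
  (forall n k, ~ F n `#` G k) -> (forall k, ~ contour F `#` G k) ->
  (forall n, ~ F n `#` contour G) -> ~ contour F `#` contour G.
Proof.
move=> nFG ncFG nFcG.
have /choice[AB ABP] (nk : nat * nat) : exists ab : set X * set X,
    [/\ F nk.1 ab.1, G nk.2 ab.2 & ab.1 `&` ab.2 = set0].
  by have [A [B ABP]] := not_meets_disjoint (nFG nk.1 nk.2); exists (A, B).
have /choice[PQ PQP] (k : nat) : exists pqm : set X * set X * nat,
    [/\ forall n, pqm.2 < n -> F n pqm.1.1, G k pqm.1.2
       & pqm.1.1 `&` pqm.1.2 = set0].
  by have [P [Q [/contourP[m FP] ? ?]]] := not_meets_disjoint (ncFG k); exists (P, Q, m).
have /choice[RS RSP] (n : nat) : exists rsm : set X * set X * nat,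
    [/\ F n rsm.1.1, forall k, rsm.2 < k -> G k rsm.1.2
       & rsm.1.1 `&` rsm.1.2 = set0].
  by have [R [S [? /contourP[m GS] ?]]] := not_meets_disjoint (nFcG n); exists (R, S, m).
pose CD n k := if n <= k then if (RS n).2 < k then (RS n).1 else AB (n, k)
               else if (PQ k).2 < n then (PQ k).1 else AB (n, k).
have CDP n k : [/\ F n (CD n k).1, G k (CD n k).2
                  & (CD n k).1 `&` (CD n k).2 = set0].
  have := ABP (n, k); have [FP GQ PQ0] := PQP k; have [FR GS RS0] := RSP n.
  rewrite /CD; case: (leqP n k) => _; case: ifP => // lt_nk _; split=> //.
    exact: GS.
  exact: FP.
pose A n := \bigcap_k (CD n k).1; pose B k := \bigcap_n (CD n k).2.
have FA n : F n (A n).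
  have [FR _ _] := RSP n.
  (* From this bound on, both tests of the first branch succeed, so [CD n k] is the fixed pair
     [(RS n).1]. *)
  apply: (@filter_bigcap_eventually_cst _ _ _ _ _ (maxn n (RS n).2.+1) FR) => k.
    by have [] := CDP n k.
  by rewrite geq_max /CD => /andP[-> ->].
have GB k : G k (B k).
  have [_ GQ _] := PQP k.
  (* The second branch requires [k < n] strictly, hence [k.+1]. *)
  apply: (@filter_bigcap_eventually_cst _ _ _ _ _ (maxn k.+1 (PQ k).2.+1) GQ) => n.
    by have [] := CDP n k.
  by rewrite geq_max /CD (leqNgt n) => /andP[-> ->].
move=> /(_ (\bigcup_n A n) (\bigcup_k B k))[||x [[n _ Ax] [k _ Bx]]].
- by apply/contourP; exists 0 => n _; apply: filterS (FA n) => x; exists n.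
- by apply/contourP; exists 0 => k _; apply: filterS (GB k) => x; exists k.
(* A common point of [A n] and [B k] lies in both halves of the disjoint pair [CD n k]. *)
- have [_ _ CD0] := CDP n k.
  suff : set0 x by [].
  by rewrite -CD0; split; [exact: Ax | exact: Bx].
Qed.

(** Greedy choice: each new pair is taken beyond both coordinates of the previous one, so both
    coordinates increase strictly and no row or column is met twice. *)
Lemma exists_transversal_set (E : nat -> nat -> Prop) :
  (forall N, exists n k, [/\ N <= n, N <= k & E n k]) ->
  exists A, transversal_set A /\ forall n k, A (n, k) -> E n k.
Proof.
move=> EN.
have /choice[f fP] (N : nat) :
    exists p : nat * nat, [/\ N <= p.1, N <= p.2 & E p.1 p.2].
  by have [n [k nkP]] := EN N; exists (n, k).
pose g := fix g i := if i is j.+1 then f (maxn (g j).1 (g j).2).+1 else f 0.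
have gE i : E (g i).1 (g i).2.
  case: i => [|i] /=; first by have [] := fP 0.
  by have [] := fP (maxn (g i).1 (g i).2).+1.
have gS i : (g i).1 < (g i.+1).1 /\ (g i).2 < (g i.+1).2.
  rewrite /=; have [le1 le2 _] := fP (maxn (g i).1 (g i).2).+1.
  by move: le1 le2; rewrite !gtn_max => /andP[? _] /andP[].
have g1 : injective (fst \o g).
  by apply: ltn_homo_inj; apply: (homo_ltn ltn_trans) => i; case: (gS i).
have g2 : injective (snd \o g).
  by apply: ltn_homo_inj; apply: (homo_ltn ltn_trans) => i; case: (gS i).
exists (range g); split; first exact: transversal_set_range.
by move=> n k [i _ gi]; have := gE i; rewrite gi.
Qed.

Theorem theorem3p1 (X : Type) (F G : nat -> set_system X)
  (hF : forall n, Filter (F n)) (hG : forall k, Filter (G k))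
  (hFG : contour F `#` contour G) :
  (exists A : set (nat * nat),
      transversal_set A /\ forall n k, A (n, k) -> F n `#` G k) \/
  infinite_set [set k | contour F `#` G k] \/
  infinite_set [set n | F n `#` contour G].
Proof.
apply: contrapT => /not_orP[nA1 /not_orP[nA2 nA3]].
(* Otherwise meshing pairs occur beyond every bound, and the greedy choice yields a transversal
   set. *)
have [N0 N0P] : exists N, forall n k, N <= n -> N <= k -> ~ F n `#` G k.
  apply: contrapT => nN; apply: nA1; apply: exists_transversal_set => N.
  apply: contrapT => nE; apply: nN; exists N => n k Nn Nk FnGk.
  by apply: nE; exists n, k.
have [N1 N1P] := not_infinite_nat_bound nA2.
have [N2 N2P] := not_infinite_nat_bound nA3.
pose N := maxn N0 (maxn N1 N2).
have leN i : [/\ N0 <= N + i, N1 <= N + i & N2 <= N + i].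
  by apply/and3P; rewrite -!geq_max leq_addr.
move: hFG; rewrite -(contour_shift F N) -(contour_shift G N).
apply: contour_not_meets => [n k|k|n]; rewrite ?contour_shift.
- by apply: N0P; [case: (leN n) | case: (leN k)].
- by apply: N1P; case: (leN k).
- by apply: N2P; case: (leN n).
Qed.
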